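(* Let $G=(V,E)$ be a simple undirected graph and let $W=\{h\}\cup H\subseteq V$, $|H|\ge 4$, be a subset of vertices inducing a wheel graph in $G$ with hub $h$. Let $|H|=3q+r$, where $q$ is a positive integer and $r\in\{0,1,2\}$. Then the inequality $$\sum_{i\in H}x_i+\left(2(q-1)+\left\lfloor\frac{2r}{3}\right\rfloor\right)x_h\le 2q+\left\lfloor\frac{2r}{3}\right\rfloor$$ is valid for $\mathscr{P}_{IUC}(G)$, and it induces a facet of $\mathscr{P}_{IUC}(G[W])$ if and only if $r\ne 0$ or $q$ is odd.
   Context: All graphs are finite, simple and undirected. A subset $U\subseteq V$ of the vertices of $G=(V,E)$ is an independent union of cliques (IUC) if every connected component of the induced subgraph $G[U]$ is a complete graph (equivalently, $G[U]$ has no induced path on three vertices). The IUC polytope $\mathscr{P}_{IUC}(G)\subseteq\mathbb{R}^{V}$ is the convex hull of the incidence vectors of all IUCs of $G$. A set $W=\{h\}\cup H$ ($h\notin H$) induces a wheel graph with hub $h$ if $G[H]$ is a chordless cycle and $h$ is adjacent to every vertex of $H$. *)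

(* Defs.v *)
From HB Require Import structures.
From mathcomp Require Import all_boot all_order all_algebra.
Set Implicit Arguments.
Unset Strict Implicit.
Unset Printing Implicit Defensive.
Import Order.TTheory GRing.Theory Num.Theory.
Local Open Scope ring_scope.

(* A simple graph on a finType T is a symmetric irreflexive relation
   e : rel T; these two properties are hypotheses of the theorem. *)

Definition induced (T : finType) (e : rel T) (U : {set T}) :
  rel {x : T | x \in U} := fun x y => e (val x) (val y).
Arguments induced {T} e U.

Definition complete_graph_on (T : finType) (e : rel T) (C : {set T}) : Prop :=
  {in C &, forall x y, x != y -> e x y}.

Definition component (T : finType) (e : rel T) (x : T) : {set T} :=
  [set y | connect e x y].

Definition is_IUC (T : finType) (e : rel T) (U : {set T}) : Prop :=
  forall x : {x : T | x \in U},
    complete_graph_on (induced e U) (component (induced e U) x).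

(* The whole graph is a cycle, with s listing the vertices in cyclic order.
   The equality rules out edges other than those of the cycle, so for an induced
   subgraph G[H] this says that G[H] is a chordless cycle. *)
Definition is_cycle_graph (T : finType) (e : rel T) : Prop :=
  exists s : seq T,
    [/\ (2 < size s)%N, uniq s, (forall x, x \in s) &
        forall x y, e x y = (y == next s x) || (x == next s y)].

Definition induces_wheel (T : finType) (e : rel T) (h : T) (H : {set T}) : Prop :=
  [/\ h \notin H, is_cycle_graph (induced e H) & forall x, x \in H -> e h x].

Section Polyhedra.
Variables (R : realFieldType) (V : lmodType R).
Implicit Types (S P : V -> Prop).

Definition convex_hull S : V -> Prop := fun x =>
  exists (n : nat) (p : 'I_n -> V) (c : 'I_n -> R),
    [/\ forall i, S (p i), forall i, 0 <= c i, \sum_(i < n) c i = 1 &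
        x = \sum_(i < n) c i *: p i].

Definition affinely_independent (n : nat) (p : 'I_n -> V) : Prop :=
  forall c : 'I_n -> R,
    \sum_(i < n) c i = 0 -> \sum_(i < n) c i *: p i = 0 -> forall i, c i = 0.

(* dim P = d, where dim P is one less than the maximum number of affinely
   independent points of P; in particular dim set0 = -1. *)
Definition has_dim P (d : int) : Prop :=
  exists n : nat,
    [/\ d = n%:Z - 1,
        exists p : 'I_n -> V, affinely_independent p /\ (forall i, P (p i)) &
        forall (m : nat) (p : 'I_m -> V),
          affinely_independent p -> (forall i, P (p i)) -> (m <= n)%N].

(* In the next two definitions, f is meant to be a linear form. *)
Definition valid_ineq P (f : V -> R) (b : R) : Prop :=
  forall x, P x -> f x <= b.

Definition induces_facet P (f : V -> R) (b : R) : Prop :=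
  valid_ineq P f b /\
  exists d : int, has_dim P d /\ has_dim (fun x => P x /\ f x = b) (d - 1).

End Polyhedra.

(* The space R^T is {ffun T -> R^o}; R^o is R as a module over
   itself. *)
Definition incidence_vector (R : realFieldType) (T : finType) (U : {set T}) :
  {ffun T -> R^o} := [ffun x => (x \in U)%:R].

Definition IUC_polytope (R : realFieldType) (T : finType) (e : rel T) :
  {ffun T -> R^o} -> Prop :=
  convex_hull (fun v => exists U : {set T}, is_IUC e U /\ v = incidence_vector R U).

(* Main.v *)
Require Import Defs.
From HB Require Import structures.
From mathcomp Require Import all_boot all_order all_algebra.
From mathcomp Require Import zify ring lra.
Set Implicit Arguments.
Unset Strict Implicit.
Unset Printing Implicit Defensive.
Import Order.TTheory GRing.Theory Num.Theory.
Local Open Scope ring_scope.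

(* A vertex set is an IUC iff it induces no path on three vertices. Hence an IUC
   containing the hub meets the rim in a clique, so in at most two vertices,
   while any IUC misses one of each three consecutive rim vertices, so that
   summing over the n = |H| cyclic shifts it has at most floor(2n/3) rim
   vertices. Both cases give validity.
   For the facet, take the tight triangles {h, v_i, v_(i+1)} along the rim path
   v_0, ..., v_(n-1) and two more tight IUCs; the alternating form
   sum_i (-1)^i x_(v_i) vanishes on the n - 1 path triangles and decides whether
   the extension is affinely independent. If 3 does not divide n, two rim sets
   differing by a swap of adjacent vertices have distinct alternating sums; if n
   is odd, the closing triangle {h, v_(n-1), v_0} has a nonzero one. If n is a
   multiple of 6, every tight IUC has alternating sum zero, so the face lies in
   two independent hyperplanes. *)

(** * Independent unions of cliques as sets without induced three-vertex paths *)

(** The ends of a path x, y, z lie in the component of y. Conversely, without induced three-vertex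
    paths adjacency is transitive on distinct vertices, so any walk shortens to an edge. *)
Lemma is_IUCP (T : finType) (e : rel T) (U : {set T}) : symmetric e ->
  is_IUC e U <->
  {in U & &, forall x y z, e x y -> e y z -> x != z -> e x z}.
Proof.
move=> e_sym; split=> [iucU x y z Ux Uy Uz exy eyz xz | noP3 x0 y z].
  apply: (iucU (Sub y Uy) (Sub x Ux) (Sub z Uz)) => //; rewrite inE connect1 //.
  by rewrite /induced e_sym.
have reach (a b : {x | x \in U}) : connect (induced e U) a b -> a != b ->
    induced e U a b.
  case/connectP=> p; elim: p a => [|c p IHp] a /= => [_ -> /eqP//|].
  case/andP=> eac pcp b_last ab; have [<-//|cb] := eqVneq c b.
  exact: noP3 (valP a) (valP c) (valP b) eac (IHp c pcp b_last cb) ab.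
have symU : symmetric (induced e U) by move=> a b; exact: e_sym.
rewrite !inE => x0y x0z; apply: reach; apply: connect_trans x0z.
by rewrite (sym_connect_sym symU).
Qed.

Lemma clique_IUC (T : finType) (e : rel T) (U : {set T}) : symmetric e ->
  {in U &, forall x y, x != y -> e x y} -> is_IUC e U.
Proof.
move=> e_sym clU; apply/(is_IUCP U e_sym) => x y z Ux _ Uz _ _.
exact: clU.
Qed.

(** * Faces of convex hulls and bounds on affine independence *)

Section Polyhedra.
Variable R : realFieldType.

Lemma convex_hull_mem (V : lmodType R) (S : V -> Prop) x :
  S x -> convex_hull S x.
Proof.
move=> Sx; exists 1%N, (fun=> x), (fun=> 1).
by split; rewrite ?big_ord1 ?scale1r.
Qed.

Lemma convex_hull_valid (V : lmodType R) (S : V -> Prop)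
    (f : {linear V -> R^o}) (b : R) :
  valid_ineq S f b -> valid_ineq (convex_hull S) f b.
Proof.
move=> fS _ [k [p [c [Sp c0 c1 ->]]]].
rewrite linear_sum -[leRHS]mul1r -c1 mulr_suml ler_sum // => i _.
by rewrite linearZ ler_wpM2l ?fS.
Qed.

(** In a convex combination attaining [b], the nonnegative slacks [c i * (b - f (p i))] sum to zero,
    so every point of nonzero weight is itself tight. *)
Lemma convex_hull_face (V : lmodType R) (S : V -> Prop)
    (f g : {linear V -> R^o}) (b : R) :
  valid_ineq S f b -> (forall x, S x -> f x = b -> g x = 0) ->
  forall x, convex_hull S x -> f x = b -> g x = 0.
Proof.
move=> fS gS _ [k [p [c [Sp c0 c1 ->]]]] fb.
have slack i : 0 <= c i * (b - f (p i)) by rewrite mulr_ge0 ?subr_ge0 ?fS.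
have /eqP : \sum_i c i * (b - f (p i)) = 0.
  under eq_bigr do rewrite mulrBr.
  rewrite sumrB -mulr_suml c1 mul1r -fb linear_sum -sumrB big1 // => i _.
  by rewrite linearZ subrr.
rewrite psumr_eq0 // => /allP tight; rewrite linear_sum big1 // => i _.
have := tight i (mem_index_enum i); rewrite mulf_eq0 linearZ.
case/orP=> [/eqP->|] /=; first by rewrite scale0r.
by rewrite subr_eq0 => /eqP bi; rewrite gS ?scaler0.
Qed.

Section Coordinates.
Variable T : finType.
Local Notation V := {ffun T -> R^o}.
Local Notation delta y := (incidence_vector R [set y]).

Lemma ffun_delta_sum (x : V) : x = \sum_y (x y : R) *: delta y.
Proof.
apply/ffunP=> z; rewrite sum_ffunE (bigD1 z) //= !ffunE inE eqxx big1.
  by rewrite addr0 /GRing.scale /= mulr1.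
move=> y yz; rewrite !ffunE inE eq_sym (negPf yz).
by rewrite /GRing.scale /= mulr0.
Qed.

(* Both families are homogenized to rows: the point [p i] to [(1, p i)] and the
   equation [f j = b j] to [(- b j, f j)]; these rows are orthogonal. *)
Lemma affinely_independent_bound (m k : nat) (p : 'I_m -> V)
    (f : 'I_k -> {linear V -> R^o}) (b : 'I_k -> R) :
  affinely_independent p -> (forall i j, f j (p i) = b j) ->
  (forall c : 'I_k -> R,
     (forall y, \sum_j c j * f j (delta y) = 0) -> forall j, c j = 0) ->
  (m + k <= #|T|.+1)%N.
Proof.
move=> p_ind fb f_ind.
pose P : 'M[R]_(m, #|T|) := \matrix_(i, y) p i (enum_val y).
pose F : 'M[R]_(k, #|T|) := \matrix_(j, y) f j (delta (enum_val y)).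
pose M := row_mx (const_mx 1 : 'cV_m) P.
pose A := row_mx (\col_j - b j : 'cV_k) F.
have M_free : row_free M.
  apply: inj_row_free => c; rewrite mul_mx_row -row_mx0.
  case/eq_row_mx=> /rowP/(_ ord0) c1 /rowP cP.
  have c_sum : \sum_i c 0 i = 0.
    rewrite mxE mxE in c1; rewrite -[RHS]c1.
    by apply: eq_bigr => i _; rewrite mxE mulr1.
  apply/rowP=> i; rewrite [RHS]mxE; apply: p_ind c_sum _ i.
  apply/ffunP=> y; rewrite sum_ffunE ffunE.
  have := cP (enum_rank y); rewrite !mxE => cPy; rewrite -[RHS]cPy.
  by apply: eq_bigr => i _; rewrite ffunE mxE enum_rankK.
have A_free : row_free A.
  apply: inj_row_free => c; rewrite mul_mx_row -row_mx0.
  case/eq_row_mx=> _ /rowP cF; apply/rowP=> j; rewrite [RHS]mxE.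
  apply: f_ind j => y; have := cF (enum_rank y); rewrite !mxE => cFy.
  by rewrite -[RHS]cFy; apply: eq_bigr => j _; rewrite mxE enum_rankK.
have MA : M *m A^T = 0.
  rewrite tr_row_mx mul_row_col; apply/matrixP=> i j; rewrite !mxE.
  rewrite big_ord1 !mxE mul1r -(fb i j) {1}[p i]ffun_delta_sum linear_sum.
  apply/eqP; rewrite addrC subr_eq0; apply/eqP.
  rewrite [RHS](reindex (fun y : 'I_#|T| => enum_val y)) /=; last first.
    by apply: onW_bij; apply: enum_val_bij.
  by apply: eq_bigr => y _; rewrite linearZ !mxE.
have := mulmx0_rank_max MA.
by rewrite mxrank_tr (eqP M_free) (eqP A_free).
Qed.

End Coordinates.
End Polyhedra.

(** * Cyclic sums and rim vertices of IUCs *)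

Lemma big_cyclic_shift (S : Type) (idx : S) (op : Monoid.com_law idx) n
    (a : nat -> S) :
  a n = a 0%N -> \big[op/idx]_(i < n) a i.+1 = \big[op/idx]_(i < n) a i.
Proof.
case: n => [|n] an; first by rewrite !big_ord0.
by rewrite big_ord_recr big_ord_recl /= an Monoid.mulmC.
Qed.

(** This counts the rim set of indices not divisible by 3, which attains the bound on rim vertices
    of an IUC. *)
Lemma sum_mod3_neq0 n : (\sum_(i < n) (i %% 3 != 0) = (2 * n) %/ 3)%N.
Proof.
by elim: n => [|n IHn]; rewrite ?big_ord0 // big_ord_recr /= IHn; lia.
Qed.

(* [v] enumerates the rim cyclically and is periodic with period [n]. *)
Record wheel_enum (T : finType) (e : rel T) (h : T) (n : nat) (v : nat -> T) :
    Prop := WheelEnum {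
  rim_eq : forall i j, (v i == v j) = (i == j %[mod n]);
  rim_hub : forall i, (v i == h) = false;
  hub_adj : forall i, e h (v i);
  rim_adj : forall i j,
    e (v i) (v j) = (j == i.+1 %[mod n]) || (i == j.+1 %[mod n]) }.

Section Wheel.
Variables (T : finType) (e : rel T) (h : T) (n : nat) (v : nat -> T).
Hypotheses (e_sym : symmetric e) (n_ge4 : (4 <= n)%N).
Hypothesis wheel : wheel_enum e h n v.

Lemma rim_eq_lt i j : (i < n)%N -> (j < n)%N -> (v i == v j) = (i == j).
Proof. by move=> ilt jlt; rewrite (rim_eq wheel) !modn_small. Qed.

Lemma rim_per i : v (i + n)%N = v i.
Proof. by apply/eqP; rewrite (rim_eq wheel) modnDr. Qed.

(** Adjacency free of residues, in a form that linear arithmetic decides; the last two disjuncts are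
    the edge closing the rim. *)
Lemma rim_adj_lt i j : (i < n)%N -> (j < n)%N ->
  e (v i) (v j) = [|| j == i.+1, i == j.+1, (i == 0) && (j == n.-1)
                    | (j == 0) && (i == n.-1)]%N.
Proof.
have succ_mod k : (k < n -> k.+1 %% n = if k == n.-1 then 0 else k.+1)%N.
  move=> klt; case: eqP => [->|kn]; first by rewrite prednK ?modnn //; lia.
  by rewrite modn_small //; lia.
move=> ilt jlt; rewrite (rim_adj wheel) !succ_mod // (modn_small ilt).
rewrite (modn_small jlt).
by case: (i =P n.-1) => ?; case: (j =P n.-1) => ?; lia.
Qed.

Lemma IUC_hub_clique (U : {set T}) i j : is_IUC e U -> h \in U ->
  v i \in U -> v j \in U -> v i != v j -> e (v i) (v j).
Proof.
move=> /(is_IUCP _ e_sym) noP3 Uh Ui Uj; apply: (noP3 _ h) => //.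
  by rewrite e_sym (hub_adj wheel).
exact: (hub_adj wheel).
Qed.

Lemma rim_sumE (S : nmodType) (U : {set T}) (f : nat -> S) :
  \sum_(i < n) f i *+ (v i \in U) = \sum_(i in [set i : 'I_n | v i \in U]) f i.
Proof.
rewrite [RHS]big_mkcond; apply: eq_bigr => i _.
by rewrite inE; case: ifP; rewrite ?mulr1n ?mulr0n.
Qed.

Lemma rim_countE (U : {set T}) :
  (\sum_(i < n) (v i \in U) = #|[set i : 'I_n | v i \in U]|)%N.
Proof.
rewrite -sum1_card [RHS]big_mkcond; apply: eq_bigr => i _.
by rewrite inE; case: ifP.
Qed.

(** Three rim vertices together with the hub would form a triangle on the rim, which a cycle of
    length at least 4 lacks. *)
Lemma IUC_hub_rim_le2 (U : {set T}) : is_IUC e U -> h \in U ->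
  (\sum_(i < n) (v i \in U) <= 2)%N.
Proof.
move=> iucU Uh; rewrite rim_countE leqNgt; apply/negP.
case/card_gt2P=> i [j [k [[]]]]; rewrite !inE => Ui Uj Uk [].
rewrite -!(inj_eq val_inj) /= => ij jk ki.
have := IUC_hub_clique iucU Uh Ui Uj; have := IUC_hub_clique iucU Uh Uj Uk.
have := IUC_hub_clique iucU Uh Uk Ui; rewrite !rim_eq_lt // !rim_adj_lt //.
have := ltn_ord i; have := ltn_ord j; have := ltn_ord k.
by move: (val i) (val j) (val k) ij jk ki n_ge4 {Ui Uj Uk} => /=; lia.
Qed.

(** For n >= 4 the vertices i and i + 2 are distinct and nonadjacent, so three consecutive rim
    vertices induce a path. *)
Lemma IUC_consecutive_le2 (U : {set T}) i : is_IUC e U ->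
  ((v i \in U) + (v i.+1 \in U) + (v i.+2 \in U) <= 2)%N.
Proof.
move=> /(is_IUCP _ e_sym) noP3.
case Ui: (v i \in U); case Ui1: (v i.+1 \in U); case Ui2: (v i.+2 \in U) => //.
have neq_mod k : (0 < k < 4)%N -> (i == i + k %[mod n]) = false.
  by move=> k_lt4; rewrite -{1}[i]addn0 eqn_modDl mod0n modn_small; lia.
have e_succ j : e (v j) (v j.+1) by rewrite (rim_adj wheel) eqxx.
have := noP3 _ _ _ Ui Ui1 Ui2 (e_succ i) (e_succ i.+1).
rewrite (rim_eq wheel) (rim_adj wheel) -addn2 neq_mod // => /(_ isT).
by rewrite -addSn -!(addn1 i) -addnA neq_mod // eqn_modDl !modn_small //; lia.
Qed.

(** Each [a i] occurs in exactly three windows of three consecutive indices. *)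
Lemma rim_triple_sum (S : nmodType) (a : nat -> S) :
  (forall i, a (i + n)%N = a i) ->
  \sum_(i < n) (a i + a i.+1 + a i.+2) =
    \sum_(i < n) a i + \sum_(i < n) a i + \sum_(i < n) a i.
Proof.
move=> a_per; rewrite !big_split /=.
rewrite (big_cyclic_shift _ (a := fun i => a i.+1)); last exact: (a_per 1%N).
by rewrite (big_cyclic_shift _ (a := a)) ?(a_per 0%N).
Qed.

Lemma IUC_rim_le (U : {set T}) : is_IUC e U ->
  (\sum_(i < n) (v i \in U) <= (2 * n) %/ 3)%N.
Proof.
move=> iucU; set s := (\sum_(i < n) _)%N.
have triple : (\sum_(i < n) ((v i \in U) + (v i.+1 \in U) + (v i.+2 \in U))
    = s + s + s)%N.
  apply: (@rim_triple_sum nat (fun i => (v i \in U) : nat)) => i.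
  by rewrite rim_per.
suff : (s + s + s <= n * 2)%N by lia.
rewrite -triple -[n in leqRHS]card_ord -sum_nat_const.
by apply: leq_sum => i _; exact: IUC_consecutive_le2.
Qed.
End Wheel.

(** * Full dimension of the polytope and linear forms on a wheel *)

(** The empty set and the singletons are IUCs, and their incidence vectors are affinely
    independent. *)
Lemma has_dim_IUC_polytope (R : realFieldType) (T : finType) (e : rel T) :
  symmetric e -> has_dim (@IUC_polytope R T e) #|T|%:Z.
Proof.
move=> e_sym; exists #|T|.+1; split; first lia.
  pose p (i : 'I_#|T|.+1) := if unlift ord0 i is Some j
    then incidence_vector R [set enum_val j] else incidence_vector R set0.
  exists p; split=> [c | i].
    rewrite !big_ord_recl /p unlift_none => c_sum /ffunP c_pt.
    have c_lift j : c (lift ord0 j) = 0.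
      have := c_pt (enum_val j); rewrite !ffunE sum_ffunE (bigD1 j) //=.
      rewrite !ffunE !liftK !ffunE !inE eqxx scaler0 add0r big1 ?addr0.
        by rewrite /GRing.scale /= mulr1.
      move=> k kj; rewrite liftK !ffunE !inE (inj_eq enum_val_inj) eq_sym.
      by rewrite (negPf kj) scaler0.
    move=> i; case: (unliftP ord0 i) => [j|] -> //.
    by move: c_sum; rewrite big1 ?addr0.
  rewrite /p; case: unlift => [j|]; apply: convex_hull_mem.
    exists [set enum_val j]; split=> //; apply: clique_IUC => // x y.
    by rewrite !inE => /eqP-> /eqP->; rewrite eqxx.
  exists set0; split=> //; apply: clique_IUC => // x y.
  by rewrite inE.
(* The general bound with an empty family of equations. *)
move=> m p p_ind _; rewrite -[m]addn0.
by apply: (affinely_independent_bound (f := fun=> \0) (b := fun=> 0) p_ind)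
  => [i []|c _ []].
Qed.

(** Rim weights and hub weight stay arbitrary so that the facet form and the alternating form share
    their evaluations. *)
Definition wheel_form (R : realFieldType) (T : finType) (h : T) (n : nat)
    (v : nat -> T) (w : nat -> R) (w' : R) (x : {ffun T -> R^o}) : R^o :=
  \sum_(i < n) w i * x (v i) + w' * x h.

Fact wheel_form_is_linear (R : realFieldType) (T : finType) (h : T) (n : nat)
    (v : nat -> T) (w : nat -> R) (w' : R) : linear (wheel_form h n v w w').
Proof.
move=> a x y; rewrite /wheel_form /GRing.scale /= mulrDr mulr_sumr addrACA.
rewrite -big_split !ffunE; congr (_ + _); last by rewrite /GRing.scale /=; ring.
by apply: eq_bigr => i _; rewrite !ffunE /GRing.scale /=; ring.
Qed.

HB.instance Definition _ (R : realFieldType) (T : finType) (h : T) (n : nat)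
    (v : nat -> T) (w : nat -> R) (w' : R) :=
  GRing.isLinear.Build R {ffun T -> R^o} R^o *:%R (wheel_form h n v w w')
    (wheel_form_is_linear h n v w w').

(** * Validity, and the alternating form on tight IUCs *)

Section WheelFacet.
Variables (R : realFieldType) (T : finType) (e : rel T) (h : T) (n : nat).
Variable v : nat -> T.
Hypotheses (e_sym : symmetric e) (n_ge4 : (4 <= n)%N).
Hypothesis wheel : wheel_enum e h n v.
Local Notation K := ((2 * n) %/ 3)%N.
Local Notation V := {ffun T -> R^o}.
Local Notation facet_form := (wheel_form h n v (fun=> 1) (K%:R - 2 : R)).
Local Notation alternating_form :=
  (wheel_form h n v (fun i => (-1) ^+ i) (0 : R)).
Local Notation inc U := (incidence_vector R U).

Lemma wheel_form_inc (w : nat -> R) (w' : R) (U : {set T}) :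
  wheel_form h n v w w' (inc U) =
    \sum_(i < n) w i *+ (v i \in U) + w' *+ (h \in U).
Proof.
rewrite /wheel_form ffunE mulr_natr; congr (_ + _).
by apply: eq_bigr => i _; rewrite ffunE mulr_natr.
Qed.

Lemma wheel_form_rim_delta (w : nat -> R) (w' : R) k : (k < n)%N ->
  wheel_form h n v w w' (inc [set v k]) = w k.
Proof.
move=> kn; rewrite wheel_form_inc inE eq_sym (rim_hub wheel) mulr0n addr0.
rewrite (bigD1 (Ordinal kn)) //= !inE eqxx big1 ?addr0 // => i.
by rewrite inE -val_eqE (rim_eq_lt wheel) //= => /negPf->.
Qed.

Lemma facet_form_inc (U : {set T}) :
  facet_form (inc U) =
    (\sum_(i < n) (v i \in U))%N%:R + (K%:R - 2) *+ (h \in U).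
Proof. by rewrite wheel_form_inc natr_sum. Qed.

Lemma facet_form_IUC_le (U : {set T}) : is_IUC e U ->
  facet_form (inc U) <= K%:R.
Proof.
move=> iucU; rewrite facet_form_inc; case Uh: (h \in U).
  rewrite mulr1n addrC -addrA gerDl addrC subr_le0.
  by rewrite (ler_nat _ _ 2) (IUC_hub_rim_le2 e_sym n_ge4 wheel).
by rewrite mulr0n addr0 ler_nat (IUC_rim_le e_sym n_ge4 wheel).
Qed.

Lemma facet_form_valid :
  valid_ineq (@IUC_polytope R T e) facet_form K%:R.
Proof.
by apply: convex_hull_valid => _ [U [iucU ->]]; exact: facet_form_IUC_le.
Qed.

(** For even n a cyclic shift preserves the sum and also negates it. *)
Lemma alternating_sum_even : ~~ odd n -> \sum_(i < n) (-1 : R) ^+ i = 0.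
Proof.
move=> n_even.
have := big_cyclic_shift (S := R) +%R (n := n) (a := fun i => (-1) ^+ i).
rewrite -signr_odd (negPf n_even) => /(_ erefl).
under eq_bigr do rewrite exprS mulN1r.
by rewrite sumrN => ?; lra.
Qed.

(** A tight IUC with the hub has two adjacent rim vertices, whose signs cancel. A tight IUC without
    it has exactly two members in every window of three, and the windows are then summed with
    alternating signs. *)
Lemma alternating_form_tight (U : {set T}) : ~~ odd n -> (3 %| n)%N ->
  is_IUC e U -> facet_form (inc U) = K%:R -> alternating_form (inc U) = 0.
Proof.
move=> n_even n_div3 iucU; rewrite facet_form_inc wheel_form_inc mul0rn addr0.
case Uh: (h \in U).
  rewrite mulr1n => tight.
  have : (\sum_(i < n) (v i \in U))%N%:R = 2 :> R.
    by apply: (addIr (K%:R - 2)); rewrite tight addrC subrK.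
  rewrite rim_countE => /eqP; rewrite eqr_nat => /cards2P[i [j [ij Uij]]].
  rewrite rim_sumE Uij big_setU1 ?inE // big_set1.
  have memU (k : 'I_n) : (v k \in U) = (k == i) || (k == j).
    by rewrite -in_set2 -Uij inE.
  have Ui : v i \in U by rewrite memU eqxx.
  have Uj : v j \in U by rewrite memU eqxx orbT.
  have := IUC_hub_clique e_sym wheel iucU Uh Ui Uj.
  rewrite (rim_eq_lt wheel) // (rim_adj_lt n_ge4 wheel) // => /(_ ij) adj.
  (* As n is even, the closing edge also joins indices of opposite parity. *)
  have odd_j : odd j = ~~ odd i.
    by move: (ltn_ord i) (ltn_ord j) adj n_even n_ge4 => /=; lia.
  by rewrite -(signr_odd _ i) -(signr_odd _ j) odd_j; case: odd => /=; ring.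
rewrite mulr0n addr0 => /eqP; rewrite eqr_nat => /eqP tight.
have triple i : (i < n)%N ->
    ((v i \in U) + (v i.+1 \in U) + (v i.+2 \in U) = 2)%N.
  move=> ilt.
  have le2 (k : 'I_n) : true -> ((v k \in U) + (v k.+1 \in U) + (v k.+2 \in U)
      <= 2 ?= iff ((v k \in U) + (v k.+1 \in U) + (v k.+2 \in U) == 2))%N.
    by move=> _; exact: leqif_eq (IUC_consecutive_le2 e_sym n_ge4 wheel k iucU).
  have [_ ] := leqif_sum le2.
  rewrite sum_nat_const card_ord.
  have -> : (\sum_(i < n) ((v i \in U) + (v i.+1 \in U) + (v i.+2 \in U))
    = K + K + K)%N.
    rewrite -tight.
    apply: (@rim_triple_sum n nat (fun i => (v i \in U) : nat)) => k.
    by rewrite (rim_per wheel).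
  (* Since 3 divides n, the total meets its upper bound exactly, which forces equality in every
     window. *)
  have -> : (K + K + K == n * 2)%N by lia.
  by move/esym/forallP/(_ (Ordinal ilt))/eqP.
pose b i : R := (-1) ^+ i *+ (v i \in U).
have b_per i : b (i + n)%N = b i.
  rewrite /b (rim_per wheel) exprD -[X in _ * X]signr_odd.
  by rewrite (negPf n_even) mulr1.
have shift1 := big_cyclic_shift +%R (b_per 0%N).
have shift2 := big_cyclic_shift +%R (n := n) (a := fun i => b i.+1) (b_per 1%N).
(* Each term is [(-1) ^+ i] times a window count, which is 2. The three cyclic sums of [b] coincide,
   so the left side is just the alternating sum of [U]. *)
have : \sum_(i < n) (b i - b i.+1 + b i.+2) = 0.
  transitivity ((\sum_(i < n) (-1) ^+ i : R) * 2); last first.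
    by rewrite alternating_sum_even ?mul0r.
  rewrite mulr_suml.
  apply: eq_bigr => i _; have := triple i (ltn_ord i).
  move/(congr1 (fun k => k%:R : R)); rewrite !natrD => <-.
  by rewrite /b !exprS !mulN1r opprK mulNrn opprK !mulrDr !mulr_natr.
rewrite big_split /= sumrB shift2 shift1 subrr add0r; exact.
Qed.

(** * Tight triangles through the hub *)

(** By periodicity of [v], the index n - 1 gives the triangle on the closing edge. *)
Definition spoke_set i : {set T} := [set h; v i; v i.+1].

Lemma spoke_IUC i : is_IUC e (spoke_set i).
Proof.
apply: clique_IUC => // x y.
have e_succ : e (v i) (v i.+1) by rewrite (rim_adj wheel) eqxx.
rewrite !inE => /orP[/orP[]|]/eqP-> /orP[/orP[]|]/eqP->;
  rewrite ?eqxx // => _; rewrite ?(hub_adj wheel) // e_sym ?(hub_adj wheel) //.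
Qed.

(** The weights [w] need not have period n, hence the reduced index of the second end. *)
Lemma wheel_form_spoke (w : nat -> R) (w' : R) i : (i < n)%N ->
  wheel_form h n v w w' (inc (spoke_set i)) = w i + w (i.+1 %% n)%N + w'.
Proof.
move=> ilt; have n_gt0 : (0 < n)%N by lia.
have jlt : (i.+1 %% n < n)%N by rewrite ltn_mod.
rewrite wheel_form_inc !inE eqxx mulr1n; congr (_ + _); rewrite rim_sumE.
have -> : [set k : 'I_n | v k \in spoke_set i] = [set Ordinal ilt; Ordinal jlt].
  apply/setP=> k; rewrite !inE (rim_hub wheel) !(rim_eq wheel).
  by rewrite -!val_eqE /= (modn_small ilt) (modn_small (ltn_ord k)).
rewrite big_setU1 ?big_set1 // inE -val_eqE /=.
have [->|in1] := eqVneq i n.-1; first by rewrite prednK // modnn; lia.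
by rewrite modn_small; lia.
Qed.

Lemma facet_form_spoke i : (i < n)%N -> facet_form (inc (spoke_set i)) = K%:R.
Proof. by move=> ilt; rewrite wheel_form_spoke //; ring. Qed.

(* Any affine dependency is killed on the path triangles by the two functionals
   [1 - x h] and [alternating_form], which leaves a 2 x 2 system for the
   coefficients of [y] and [z]. *)
Lemma rim_path_affinely_independent (y z : V) :
  (1 - y h : R) * alternating_form z != (1 - z h : R) * alternating_form y ->
  affinely_independent (fun i : 'I_n.+1 =>
    if (i < n.-1)%N then inc (spoke_set i)
    else if i == n.-1 :> nat then y else z).
Proof.
move=> det_neq0 c c_sum c_pt; pose d k := c (inord k).
have cd (i : 'I_n.+1) : c i = d i by rewrite /d inord_val.
have n_gt0 : (0 < n)%N by lia.
have split_sum (S : nmodType) (G : nat -> S) :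
    \sum_(i < n.+1) G i = \sum_(i < n.-1) G i + G n.-1 + G n.
  by clear -n_gt0; case: n n_gt0 G => // k _ G; rewrite !big_ord_recr.
have {}c_sum : \sum_(i < n.-1) d i + d n.-1 + d n = 0.
  by rewrite -split_sum -[RHS]c_sum; apply: eq_bigr => i _; rewrite cd.
have {}c_pt :
    \sum_(i < n.-1) d i *: inc (spoke_set i) + d n.-1 *: y + d n *: z = 0.
  rewrite -[RHS]c_pt; under [RHS]eq_bigr do rewrite cd.
  rewrite (split_sum _ (fun i => d i *: (if (i < n.-1)%N then inc (spoke_set i)
    else if i == n.-1 then y else z))).
  rewrite ltnn eqxx ltnNge leq_pred /= (gtn_eqF (_ : n.-1 < n)%N) ?prednK //.
  by congr (_ + _ + _); apply: eq_bigr => i _; rewrite ltn_ord.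
have alt0 : d n.-1 * alternating_form y + d n * alternating_form z = 0.
  have := congr1 alternating_form c_pt.
  rewrite !linearD !linearZ linear0 linear_sum big1 ?add0r // => i _;
  rewrite linearZ /= wheel_form_spoke; last by have := ltn_ord i; lia.
  rewrite modn_small; last by have := ltn_ord i; lia.
  by rewrite exprS mulN1r subrr add0r /= scaler0.
have hub0 : \sum_(i < n.-1) d i + d n.-1 * y h + d n * z h = 0.
  have /ffunP/(_ h) := c_pt; rewrite !ffunE sum_ffunE => hubE.
  rewrite -[RHS]hubE; congr (_ + _ + _); apply: eq_bigr => i _.
  by rewrite !ffunE !inE eqxx /GRing.scale /= mulr1.
set a := d n.-1 in c_sum c_pt alt0 hub0; set b := d n in c_sum c_pt alt0 hub0.
move: c_sum hub0 alt0 det_neq0; set s := \sum_(i < _) _.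
set Y := alternating_form y; set Z := alternating_form z.
move=> c_sum hub0 alt0; rewrite -subr_eq0 => det_neq0.
have hub_gap : a * (1 - y h) + b * (1 - z h) = 0.
  rewrite -[RHS](subrr 0) -{1}c_sum -hub0; ring.
(* Cramer's rule for the system [hub_gap], [alt0], with determinant nonzero by [det_neq0]. *)
have a0 : a = 0.
  apply/eqP; rewrite -[_ == 0](orbF) -(negPf det_neq0) -mulf_eq0.
  apply/eqP; transitivity ((a * (1 - y h) + b * (1 - z h)) * Z -
     (a * Y + b * Z) * (1 - z h)); first by ring.
  by rewrite hub_gap alt0; ring.
have b0 : b = 0.
  apply/eqP; rewrite -[_ == 0](orbF) -(negPf det_neq0) -mulf_eq0.
  apply/eqP; transitivity ((a * Y + b * Z) * (1 - y h)
    - (a * (1 - y h) + b * (1 - z h)) * Y); first by ring.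
  by rewrite hub_gap alt0; ring.
(* Among the path triangles, [v k] lies only on number k and, if k > 0, number k - 1, so its
   coordinate gives [d k] by induction. *)
have d0 k : (k < n.-1)%N -> d k = 0.
  elim/ltn_ind: k => k IHk klt.
  have /ffunP/(_ (v k)) := c_pt; rewrite !ffunE sum_ffunE a0 b0 !scale0r !addr0.
  rewrite (bigD1 (Ordinal klt)) //= big1 ?addr0.
    by rewrite !ffunE !inE eqxx orbT /GRing.scale /= mulr1.
  move=> i; rewrite -val_eqE /= => ik; have ilt := ltn_ord i.
  rewrite !ffunE; case: (ltngtP i k) ik => // [ik|ki] _.
    by rewrite IHk ?scale0r.
  rewrite !inE (rim_hub wheel) !(rim_eq_lt wheel); [|lia..].
  by rewrite ltn_eqF // ltn_eqF ?scaler0 //; lia.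
move=> i; rewrite cd; have := ltn_ord i.
have [/d0->//|] := ltnP i n.-1 => ni iltn.
have [->//|in1] := eqVneq (i : nat) n.-1.
by have -> : i = n :> nat by lia.
Qed.

(** * Tight rim sets *)

Definition rim_set (A : pred nat) : {set T} := [set v i | i : 'I_n & A i].

Lemma mem_rim_set (A : pred nat) i : (i < n)%N -> (v i \in rim_set A) = A i.
Proof.
move=> ilt; apply/imsetP/idP => [[j /[!inE] Aj /eqP]|Ai].
  by rewrite (rim_eq_lt wheel) // => /eqP->.
by exists (Ordinal ilt); rewrite ?inE.
Qed.

Lemma hub_rim_set (A : pred nat) : (h \in rim_set A) = false.
Proof. by apply/imsetP=> -[j _ /esym/eqP]; rewrite (rim_hub wheel). Qed.

(** The condition forbids every three-vertex path in the set, induced or not; on a rim without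
    triangles this loses nothing and leaves pure index arithmetic. *)
Lemma rim_set_IUC (A : pred nat) :
  (forall i j k, (i < n)%N -> (j < n)%N -> (k < n)%N -> A i -> A j -> A k ->
     e (v i) (v j) -> e (v j) (v k) -> i != k -> False) ->
  is_IUC e (rim_set A).
Proof.
move=> no3; apply/(is_IUCP _ e_sym) => x y z.
case/imsetP=> i /[!inE] Ai -> /imsetP[j /[!inE] Aj ->] /imsetP[k /[!inE] Ak ->].
by move=> eij ejk /[!(rim_eq_lt wheel)] // ik; case: (no3 i j k).
Qed.

Lemma wheel_form_rim_set (w : nat -> R) (w' : R) (A : pred nat) :
  wheel_form h n v w w' (inc (rim_set A)) = \sum_(i < n) w i *+ A i.
Proof.
rewrite wheel_form_inc hub_rim_set mulr0n addr0; apply: eq_bigr => i _.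
by rewrite mem_rim_set.
Qed.

(* [non3_swap q] trades the vertex 3q - 1 of [non3] for 3q, which is on the rim
   iff 3q < n. *)
Definition non3 : pred nat := fun i => (i %% 3 != 0)%N.

Definition non3_swap q : pred nat := fun i =>
  ((i == 3 * q) || (i != (3 * q).-1) && non3 i)%N.

(** Runs of consecutive members have length at most 2, and none wraps around because index 0 is
    absent. *)
Lemma non3_IUC : is_IUC e (rim_set non3).
Proof.
apply: rim_set_IUC => i j k ilt jlt klt.
by rewrite !(rim_adj_lt n_ge4 wheel) // /non3; lia.
Qed.

(** Dropping 3q - 1 makes 3q start a new run, of length n - 3q <= 2, which the absence of index 0
    ends. *)
Lemma non3_swap_IUC q : (3 * q < n < 3 * q + 3)%N ->
  is_IUC e (rim_set (non3_swap q)).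
Proof.
move=> nq; apply: rim_set_IUC => i j k ilt jlt klt.
rewrite !(rim_adj_lt n_ge4 wheel) // /non3_swap /non3 => Ai Aj Ak adj1 adj2.
by case/or4P: adj1 => [/eqP|/eqP|/andP[/eqP+ /eqP]|/andP[/eqP+ /eqP]] *;
  case/or4P: adj2 => [/eqP|/eqP|/andP[/eqP+ /eqP]|/andP[/eqP+ /eqP]] *;
  subst; lia.
Qed.

Lemma facet_form_non3 : facet_form (inc (rim_set non3)) = K%:R.
Proof. by rewrite wheel_form_rim_set -sum_mod3_neq0 natr_sum. Qed.

Lemma wheel_form_non3_swap (w : nat -> R) (w' : R) q : (0 < q)%N ->
  (3 * q < n)%N ->
  wheel_form h n v w w' (inc (rim_set (non3_swap q))) =
  wheel_form h n v w w' (inc (rim_set non3)) + w (3 * q)%N - w (3 * q).-1.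
Proof.
move=> q_gt0 qn; rewrite !wheel_form_rim_set.
have point k : (k < n)%N -> w k = \sum_(i < n) w i *+ (i == k :> nat).
  move=> kn; rewrite (bigD1 (Ordinal kn)) //= eqxx big1 ?addr0 // => i.
  by rewrite -val_eqE /= => /negPf->.
rewrite (point (3 * q)%N) // (point (3 * q).-1); last lia.
rewrite -big_split -sumrB; apply: eq_bigr => i _ /=; rewrite /non3_swap /non3.
case: eqP => [->|i1]; last case: eqP => [->|i2].
- by rewrite modnMr (_ : (3 * q == (3 * q).-1)%N = false); [ring|lia].
- by rewrite (_ : ((3 * q).-1 %% 3 != 0)%N); [ring|lia].
- by ring.
Qed.

(** * Facets when the wheel is the whole graph *)

Hypothesis rim_cover : forall x, x = h \/ exists i : 'I_n, x = v i.

Lemma card_wheel : #|T| = n.+1.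
Proof.
have -> : #|T| = #|h |: [set v i | i : 'I_n]|.
  rewrite -cardsT; congr #|pred_of_set _|; apply/setP=> x; rewrite !inE.
  by case: (rim_cover x) => [->|[i ->]]; rewrite ?eqxx // imset_f ?orbT.
rewrite cardsU1 card_imset ?card_ord.
  case: imsetP => // -[i _ /esym/eqP]; by rewrite (rim_hub wheel).
by move=> i j /eqP; rewrite (rim_eq_lt wheel) // => /eqP/val_inj.
Qed.

(** The polytope has dimension n + 1, so a facet needs n + 1 affinely independent tight points, and
    the equation of the face allows no more. *)
Lemma facet_of_points (p : 'I_n.+1 -> V) : affinely_independent p ->
  (forall i, IUC_polytope e (p i) /\ facet_form (p i) = K%:R) ->
  induces_facet (@IUC_polytope R T e) facet_form K%:R.
Proof.
move=> p_ind p_face; split; first exact: facet_form_valid.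
exists n.+1%:Z; split.
  by rewrite -card_wheel; exact: has_dim_IUC_polytope.
exists n.+1; split=> [//||m p' p'_ind p'_face]; first by exists p.
have := affinely_independent_bound (f := fun _ : 'I_1 => facet_form)
  (b := fun=> K%:R) p'_ind (fun i _ => (p'_face i).2).
rewrite card_wheel addn1 ltnS; apply=> c /(_ (v 0%N)) + j.
by rewrite !big_ord1 !ord1 /= wheel_form_rim_delta ?mulr1 //; lia.
Qed.

(** Both extra sets miss the hub, so the determinant is the difference of their alternating sums,
    which is 2 or -2 because 3q - 1 and 3q have opposite signs. *)
Lemma facet_of_nondiv3 q : (0 < q)%N -> (3 * q < n < 3 * q + 3)%N ->
  induces_facet (@IUC_polytope R T e) facet_form K%:R.
Proof.
move=> q_gt0 nq; have /andP[qn _] := nq.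
have swapE := wheel_form_non3_swap _ _ q_gt0 qn.
apply: facet_of_points (rim_path_affinely_independent
  (y := inc (rim_set non3)) (z := inc (rim_set (non3_swap q))) _) _.
  rewrite !ffunE !hub_rim_set !subr0 !mul1r swapE -subr_eq0.
  set s := (-1) ^+ (3 * q).-1; have -> : (-1) ^+ (3 * q) = - s.
    by rewrite -{1}(@prednK (3 * q)) ?muln_gt0 // exprS mulN1r.
  have -> X : X - s - s - X = s * (- 2) :> R by ring.
  by rewrite mulf_neq0 ?signr_eq0 // oppr_eq0 pnatr_eq0.
move=> i; case: ifP => [ilt|_]; last case: ifP => _; split.
- by apply: convex_hull_mem; exists (spoke_set i); split=> //; exact: spoke_IUC.
- by rewrite facet_form_spoke //; lia.
- by apply: convex_hull_mem; exists (rim_set non3); split=> //; exact: non3_IUC.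
- exact: facet_form_non3.
- apply: convex_hull_mem; exists (rim_set (non3_swap q)).
  by split=> //; exact: non3_swap_IUC.
- by rewrite swapE facet_form_non3 addrK.
Qed.

(** The closing triangle contains the hub and, n - 1 being even, has alternating sum 2; pairing it
    with a rim set gives a nonzero determinant. *)
Lemma facet_of_odd : odd n ->
  induces_facet (@IUC_polytope R T e) facet_form K%:R.
Proof.
move=> n_odd; have n_gt0 : (0 < n)%N by lia.
apply: facet_of_points (rim_path_affinely_independent
  (y := inc (spoke_set n.-1)) (z := inc (rim_set non3)) _) _.
  rewrite !ffunE hub_rim_set !inE eqxx subrr mul0r subr0 mul1r.
  rewrite wheel_form_spoke ?prednK // modnn -signr_odd.
  have -> : odd n.-1 = false by lia.
  by rewrite eq_sym addr0 (_ : 1 + 1 = 2%:R :> R) ?pnatr_eq0.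
move=> i; case: ifP => [ilt|_]; last case: ifP => _; split.
- by apply: convex_hull_mem; exists (spoke_set i); split=> //; exact: spoke_IUC.
- by rewrite facet_form_spoke //; lia.
- apply: convex_hull_mem; exists (spoke_set n.-1).
  by split=> //; exact: spoke_IUC.
- by rewrite facet_form_spoke // prednK.
- by apply: convex_hull_mem; exists (rim_set non3); split=> //; exact: non3_IUC.
- exact: facet_form_non3.
Qed.

(** Two independent equations leave at most n affinely independent tight points, while a facet of a
    polytope of dimension n + 1 needs n + 1. *)
Lemma not_facet_even_div3 : ~~ odd n -> (3 %| n)%N ->
  ~ induces_facet (@IUC_polytope R T e) facet_form K%:R.
Proof.
move=> n_even n_div3 [_ [d [[m [dm _ m_max]] [m' [dm' [p [p_ind p_face]] _]]]]].
have [m0 [m0E [p0 [p0_ind p0_P]] _]] := @has_dim_IUC_polytope R T e e_sym.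
have := m_max _ _ p0_ind p0_P.
pose f (j : 'I_2) : {linear V -> R^o} :=
  if j == ord0 then (facet_form : {linear V -> R^o})
  else (alternating_form : {linear V -> R^o}).
have := affinely_independent_bound (f := f)
  (b := fun j : 'I_2 => if j == ord0 then K%:R else 0) p_ind.
suff fP : (forall i j, f j (p i) = if j == ord0 then K%:R else 0) /\
    (forall c : 'I_2 -> R, (forall y,
      \sum_j c j * f j (inc [set y]) = 0) -> forall j, c j = 0).
  by case: fP => fP1 fP2 /(_ fP1 fP2); rewrite card_wheel in m0E *; lia.
split=> [i j | c c0].
  rewrite /f; have [pi_hull pi_tight] := p_face i; case: ifP => _ //.
  apply: convex_hull_face pi_hull pi_tight => _ [U [iucU ->]].
    exact: facet_form_IUC_le.
  exact: alternating_form_tight.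
(* At [v 0] and [v 1] the two forms take the values 1, 1 and 1, -1, which makes them independent. *)
have := c0 (v 0%N); have := c0 (v 1%N).
rewrite !big_ord_recl !big_ord0 /f /= !wheel_form_rim_delta; [|lia..].
rewrite expr0 expr1 !mulr1 mulrN1 !addr0 => c01 c01'.
move=> j; case: (unliftP ord0 j) => [k|] ->; last lra.
rewrite ord1; lra.
Qed.

End WheelFacet.

(** * Enumerating a wheel and passing to the induced subgraph *)

Lemma next_nth_modn (T : eqType) (x0 : T) (s : seq T) i : uniq s ->
  (i < size s)%N -> next s (nth x0 s i) = nth x0 s (i.+1 %% size s).
Proof.
move=> s_uniq ilt; rewrite next_nth mem_nth // index_uniq //.
case: s ilt {s_uniq} => // y s /= ilt.
(* At the last position the lookup in the tail overruns and returns its default, the head [y]. *)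
have [->|i_neq] := eqVneq i (size s); first by rewrite modnn nth_default.
have ilt' : (i < size s)%N by lia.
by rewrite modn_small //=; apply: set_nth_default.
Qed.

Lemma induces_wheel_enum (T : finType) (e : rel T) (h : T) (H : {set T}) :
  induces_wheel e h H -> exists v : nat -> T,
    wheel_enum e h #|H| v /\
    (forall x, (x \in H) = [exists i : 'I_#|H|, x == v i]).
Proof.
case=> hH [s [s_gt2 s_uniq s_all s_e]] hub.
have size_s : size s = #|H|.
  rewrite -(card_uniqP s_uniq) (eq_card (B := {: {x | x \in H}})).
    by rewrite card_sig; apply: eq_card.
  by move=> x; rewrite s_all.
have [x0 _] : exists x0, x0 \in s.
  case: s s_gt2 {s_uniq s_all s_e size_s} => // x0 s _.
  by exists x0; exact: mem_head.
have n_gt0 : (0 < #|H|)%N by lia.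
(* Reading the cyclic list at residues extends it to a periodic enumeration. *)
pose u i := nth x0 s (i %% #|H|).
have uH i : val (u i) \in H by exact: valP.
have u_eq i j : (u i == u j) = (i == j %[mod #|H|]).
  by rewrite /u nth_uniq ?size_s ?ltn_mod.
have u_next i : next s (u i) = u i.+1.
  rewrite /u next_nth_modn ?size_s ?ltn_mod //.
  by rewrite -addn1 modnDml addn1.
exists (val \o u); split=> [|x]; first split=> [i j|i|i|i j] /=.
- by rewrite (inj_eq val_inj) u_eq.
- by apply: contraNF hH => /eqP <-; exact: uH.
- exact/hub/uH.
- by rewrite -[LHS]/(induced e H (u i) (u j)) s_e !u_next !u_eq.
apply/idP/existsP => [xH|[i /eqP->]]; last exact: uH.
have ilt : (index (Sub x xH) s < #|H|)%N by rewrite -size_s index_mem.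
by exists (Ordinal ilt); rewrite /= /u modn_small // nth_index.
Qed.

Lemma rim_sum (S : nmodType) (T : finType) (e : rel T) (h : T) (n : nat)
    (v : nat -> T) (P : pred T) (F : T -> S) :
  wheel_enum e h n v -> (forall x, P x = [exists i : 'I_n, x == v i]) ->
  \sum_(x | P x) F x = \sum_(i < n) F (v i).
Proof.
move=> wheel P_rim.
rewrite -(big_imset (h := fun i : 'I_n => v i) (A := 'I_n) F) /=; last first.
  move=> i j _ _ /eqP; rewrite (rim_eq wheel) !modn_small //.
  by move=> /eqP/val_inj.
apply: eq_bigl => x; rewrite P_rim; apply/existsP/imsetP => [[i /eqP]|[i _ ->]].
  by exists i.
by exists i.
Qed.

Lemma induced_wheel_enum (T : finType) (e : rel T) (h : T) (n : nat)
    (v : nat -> T) (W : {set T}) (hW : h \in W) (vW : forall i, v i \in W) :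
  wheel_enum e h n v ->
  wheel_enum (induced e W) (Sub h hW) n (fun i => Sub (v i) (vW i)).
Proof.
by case=> eqv hubv adjh adjv; split=> [i j|i|i|i j];
  [exact: eqv|exact: hubv|exact: adjh|exact: adjv].
Qed.

Lemma has_dim_ext (R : realFieldType) (V : lmodType R) (P Q : V -> Prop) d :
  (forall x, P x <-> Q x) -> has_dim P d -> has_dim Q d.
Proof.
move=> PQ [n [dn [p [p_ind pP]] n_max]]; exists n; split=> //.
  by exists p; split=> // i; apply/PQ.
by move=> m p' p'_ind p'Q; apply: n_max p'_ind _ => i; apply/PQ.
Qed.

(** Needed since the form in the theorem is a plain function, only pointwise equal to a
    [wheel_form]. *)
Lemma induces_facet_ext (R : realFieldType) (V : lmodType R) (P : V -> Prop)
    (f g : V -> R) (b : R) :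
  f =1 g -> induces_facet P f b -> induces_facet P g b.
Proof.
move=> fg [f_valid [d [P_dim face_dim]]]; split.
  by move=> x Px; rewrite -fg f_valid.
exists d; split=> //; apply: has_dim_ext face_dim => x.
by rewrite fg.
Qed.

Theorem theorem15 (R : realFieldType) (T : finType) (e : rel T)
    (e_sym : symmetric e) (e_irr : irreflexive e)
    (h : T) (H : {set T}) (q r : nat)
    (H_ge4 : (4 <= #|H|)%N) (wheelW : induces_wheel e h H)
    (q_gt0 : (0 < q)%N) (r_lt3 : (r < 3)%N) (cardH : #|H| = (3 * q + r)%N) :
  valid_ineq (@IUC_polytope R T e)
    (fun x => \sum_(i in H) (x i : R)
              + (2 * (q%:R - 1) + ((2 * r) %/ 3)%:R) * (x h : R))
    (2 * q%:R + ((2 * r) %/ 3)%:R)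
  /\
  (induces_facet (@IUC_polytope R {i : T | i \in h |: H} (induced e (h |: H)))
     (fun x => \sum_(i | val i \in H) (x i : R)
               + (2 * (q%:R - 1) + ((2 * r) %/ 3)%:R) * (x (Sub h (setU11 h H)) : R))
     (2 * q%:R + ((2 * r) %/ 3)%:R)
   <-> r <> 0%N \/ odd q).
Proof.
have [v [wheel H_rim]] := induces_wheel_enum wheelW.
(* Twice n is 6q + 2r, so the right-hand side is floor(2n/3) and the hub coefficient is 2 less. *)
have bE : 2 * q%:R + ((2 * r) %/ 3)%:R = ((2 * #|H|) %/ 3)%:R :> R.
  by rewrite cardH -natrM -natrD; congr _%:R; lia.
have coefE : 2 * (q%:R - 1) + ((2 * r) %/ 3)%:R = ((2 * #|H|) %/ 3)%:R - 2 :> R.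
  by rewrite -bE; ring.
rewrite bE coefE.
have vW i : v i \in h |: H.
  have n_gt0 : (0 < #|H|)%N by lia.
  rewrite in_setU1 H_rim; apply/orP; right; apply/existsP.
  exists (Ordinal (ltn_pmod i n_gt0)).
  by rewrite (rim_eq wheel) /= modn_mod.
have wheel' := induced_wheel_enum (setU11 h H) vW wheel.
have sym' : symmetric (induced e (h |: H)) by move=> x y; exact: e_sym.
split=> [x Px|].
  have := facet_form_valid e_sym H_ge4 wheel Px; congr (_ <= _).
  rewrite /wheel_form (rim_sum _ wheel H_rim); congr (_ + _).
  by apply: eq_bigr => i _; rewrite mul1r.
pose W := {i : T | i \in h |: H}.
pose vS i : W := Sub (v i) (vW i).
pose g := wheel_form (Sub h (setU11 h H) : W) #|H| vS (fun=> 1)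
  (((2 * #|H|) %/ 3)%:R - 2 : R).
set f := fun x : {ffun W -> R^o} => _.
have H_rim' (x : W) : (val x \in H) =
    [exists i : 'I_#|H|, x == vS i].
  by rewrite H_rim; apply: eq_existsb => i; rewrite -val_eqE.
have gf : g =1 f.
  move=> x; rewrite /g /f /wheel_form (rim_sum _ wheel' H_rim').
  by congr (_ + _); apply: eq_bigr => i _; rewrite mul1r.
have cover (x : W) : x = Sub h (setU11 h H) \/
    exists i : 'I_#|H|, x = vS i.
  have := valP x; rewrite in_setU1 => /orP[/eqP xh|].
    by left; apply: val_inj.
  by rewrite H_rim' => /existsP[i /eqP->]; right; exists i.
(* If r = 0, then n = 3q has the parity of q; otherwise 3q < n < 3q + 3. *)
have [r0|r_neq0] := eqVneq r 0%N; split=> [/(induces_facet_ext (fsym gf))|].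
- move=> g_facet; right; apply: contraPT g_facet => q_even.
  by apply: (not_facet_even_div3 sym' H_ge4 wheel' cover); lia.
- case=> [//|q_odd]; apply: (induces_facet_ext gf).
  by apply: (facet_of_odd R sym' H_ge4 wheel' cover); lia.
- by move=> _; left; apply/eqP.
- move=> _; apply: (induces_facet_ext gf).
  by apply: (facet_of_nondiv3 R sym' H_ge4 wheel' cover q_gt0); lia.
Qed.
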